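(* Let $n$ be a positive integer. Then the assignment $R\mapsto MC_n(R)$ on rings, $f\mapsto MC_n(f)$ on ring morphisms, is a functor $MC_n:\mathfrak{R}\to\mathfrak{R}$.
   Context: All rings are associative with $1$; ring morphisms preserve $1$; $\mathfrak{R}$ is the category of rings. $M_m(R)$ is the ring of $m\times m$ matrices over $R$, and for a ring morphism $f:R\to S$, $M_m(f):M_m(R)\to M_m(S)$ applies $f$ entrywise. For $n\ge 1$ let $\eta^n_R:R\to M_n(R)$, $\eta^n_R(a)_{ij}=a\delta_{ij}$ (scalar matrices). Identify $M_n(M_{n^k}(R))$ with $M_{n^{k+1}}(R)$ via block matrices. For $n$ fixed, consider the direct system indexed by $k\in\mathbb{N}=\{0,1,2,\dots\}$ with objects $M_{n^k}(R)$ (so $M_{n^0}(R)=R$) and connecting maps $\eta^n_{M_{n^k}(R)}:M_{n^k}(R)\to M_{n^{k+1}}(R)$ (sending $A$ to the block diagonal matrix with $n$ diagonal blocks equal to $A$) and their composites. The $n$-matricial closure $MC_n(R)$ is the direct limit of this system in $\mathfrak{R}$, with canonical morphisms $i[R]^n_k:M_{n^k}(R)\to MC_n(R)$. For a ring morphism $f:R\to S$, $MC_n(f):MC_n(R)\to MC_n(S)$ is the unique ring morphism with $MC_n(f)\circ i[R]^n_k=i[S]^n_k\circ M_{n^k}(f)$ for all $k\in\mathbb{N}$. *)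

(* Defs.v *)
From HB Require Import structures.
From mathcomp Require Import all_boot all_algebra.
From mathcomp Require Import boolp.

Set Implicit Arguments.
Unset Strict Implicit.
Unset Printing Implicit Defensive.

Import GRing.Theory.
Local Open Scope ring_scope.
Local Open Scope quotient_scope.

Record category := Category {
  ob :> Type;
  hom : ob -> ob -> Type;
  idm : forall a, hom a a;
  comp : forall a b c, hom b c -> hom a b -> hom a c;
  compm1 : forall a b (f : hom a b), comp f (idm a) = f;
  comp1m : forall a b (f : hom a b), comp (idm b) f = f;
  compmA : forall a b c d (h : hom c d) (g : hom b c) (f : hom a b),
    comp h (comp g f) = comp (comp h g) f
}.

Definition is_functor (C D : category) (F0 : C -> D)
    (F1 : forall a b : C, hom a b -> hom (F0 a) (F0 b)) : Prop :=
  (forall a : C, F1 a a (idm a) = idm (F0 a)) /\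
  (forall (a b c : C) (g : hom b c) (f : hom a b),
     F1 a c (comp g f) = comp (F1 b c g) (F1 a b f)).

(* Bundled ring morphisms are equal as soon as their underlying functions
   are, so equality of arrows below has its usual meaning. *)
Lemma rmorph_eq (R S : pzRingType) (f g : {rmorphism R -> S}) :
  f =1 g -> f = g.
Proof.
case: f g => [f [[f1] [f2]]] [g [[g1] [g2]]] /= /funext efg.
case: _ / efg in g1 g2 *.
by rewrite (Prop_irrelevance f1 g1) (Prop_irrelevance f2 g2).
Qed.

Definition ring_id (R : pzRingType) : {rmorphism R -> R} := idfun.

Definition ring_comp (R S T : pzRingType)
    (g : {rmorphism S -> T}) (f : {rmorphism R -> S}) : {rmorphism R -> T} :=
  g \o f.

Lemma ring_comp_id (R S : pzRingType) (f : {rmorphism R -> S}) :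
  ring_comp f (ring_id R) = f.
Proof. exact: rmorph_eq. Qed.

Lemma ring_id_comp (R S : pzRingType) (f : {rmorphism R -> S}) :
  ring_comp (ring_id S) f = f.
Proof. exact: rmorph_eq. Qed.

Lemma ring_compA (R S T U : pzRingType) (h : {rmorphism T -> U})
    (g : {rmorphism S -> T}) (f : {rmorphism R -> S}) :
  ring_comp h (ring_comp g f) = ring_comp (ring_comp h g) f.
Proof. exact: rmorph_eq. Qed.

(* [pzRingType]: associative unital rings, the zero ring being allowed. *)
Definition Rings : category :=
  @Category pzRingType (fun R S => {rmorphism R -> S})
    ring_id ring_comp ring_comp_id ring_id_comp ring_compA.

Record dsystem := DSystem {
  dobj :> nat -> pzRingType;
  dmap : forall k l, (k <= l)%N -> {rmorphism dobj k -> dobj l};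
  dmap_id : forall k (h : (k <= k)%N) x, dmap h x = x;
  dmap_comp : forall k l m (h : (k <= l)%N) (h' : (l <= m)%N)
                (h'' : (k <= m)%N) x,
    dmap h' (dmap h x) = dmap h'' x
}.

Section DirectLimit.
Variable D : dsystem.

Let elt := {k : nat & D k}.

(* [u] and [v] are identified when they become equal at some later stage. *)
Definition dlim_rel (u v : elt) : bool :=
  `[< exists m (hu : (tag u <= m)%N) (hv : (tag v <= m)%N),
        dmap D hu (tagged u) = dmap D hv (tagged v) >].

Lemma dlim_rel_refl : reflexive dlim_rel.
Proof. by move=> u; apply/asboolP; exists (tag u), (leqnn _), (leqnn _). Qed.

Lemma dlim_rel_sym : symmetric dlim_rel.
Proof.
by move=> u v; apply/asboolP/asboolP => -[m [hu [hv e]]]; exists m, hv, hu.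
Qed.

Lemma dlim_rel_trans : transitive dlim_rel.
Proof.
move=> v u w /asboolP[m [hu [hv e]]] /asboolP[p [hv' [hw e']]].
have hm : (m <= maxn m p)%N by exact: leq_maxl.
have hp : (p <= maxn m p)%N by exact: leq_maxr.
apply/asboolP; exists (maxn m p), (leq_trans hu hm), (leq_trans hw hp).
rewrite -(dmap_comp hu hm) -(dmap_comp hw hp) e -e'.
by rewrite (dmap_comp _ _ (leq_trans hv hm)) (dmap_comp _ _ (leq_trans hv hm)).
Qed.

Canonical dlim_equiv :=
  EquivRel dlim_rel dlim_rel_refl dlim_rel_sym dlim_rel_trans.

Definition dlim := {eq_quot dlim_equiv}.
HB.instance Definition _ := Choice.on dlim.

Definition dlim_cl k (x : D k) : dlim :=
  \pi_({eq_quot dlim_equiv}) (Tagged (fun k => D k) x : elt).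

Lemma dlim_clP k l (x : D k) (y : D l) :
  dlim_cl x = dlim_cl y <->
  exists m (hk : (k <= m)%N) (hl : (l <= m)%N), dmap D hk x = dmap D hl y.
Proof.
split; first by move=> /eqmodP/asboolP.
by move=> h; apply/eqmodP/asboolP.
Qed.

Lemma dlim_cl_map k l (h : (k <= l)%N) (x : D k) :
  dlim_cl (dmap D h x) = dlim_cl x.
Proof.
apply/dlim_clP; exists l, (leqnn l), h.
by rewrite dmap_id.
Qed.

Lemma dlim_ex (x : dlim) : exists k (a : D k), x = dlim_cl a.
Proof. by elim/quotW: x => -[k a]; exists k, a. Qed.

Lemma dlim_ex_ge (x : dlim) : exists k, forall l, (k <= l)%N ->
  exists a : D l, x = dlim_cl a.
Proof.
have [k [a ->]] := dlim_ex x.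
by exists k => l h; exists (dmap D h a); rewrite dlim_cl_map.
Qed.

Lemma dlim_ex2 (x y : dlim) :
  exists k (a b : D k), x = dlim_cl a /\ y = dlim_cl b.
Proof.
have [k hk] := dlim_ex_ge x; have [l hl] := dlim_ex_ge y.
have [a ->] := hk (maxn k l) (leq_maxl _ _).
have [b ->] := hl (maxn k l) (leq_maxr _ _).
by exists (maxn k l), a, b.
Qed.

Lemma dlim_ex3 (x y z : dlim) :
  exists k (a b c : D k), [/\ x = dlim_cl a, y = dlim_cl b & z = dlim_cl c].
Proof.
have [k [a [b [-> ->]]]] := dlim_ex2 x y; have [l hl] := dlim_ex_ge z.
have [c ->] := hl (maxn k l) (leq_maxr _ _).
exists (maxn k l), (dmap D (leq_maxl _ _) a), (dmap D (leq_maxl _ _) b), c.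
by rewrite !dlim_cl_map.
Qed.

Definition dlim_op1 (op : forall k, D k -> D k) (x : dlim) : dlim :=
  let u := repr x in dlim_cl (op _ (tagged u)).

Definition dlim_op2 (op : forall k, D k -> D k -> D k) (x y : dlim) : dlim :=
  let u := repr x in let v := repr y in
  dlim_cl (op _ (dmap D (leq_maxl (tag u) (tag v)) (tagged u))
                (dmap D (leq_maxr (tag u) (tag v)) (tagged v))).

Lemma dlim_reprK (x : dlim) : dlim_cl (tagged (repr x)) = x.
Proof. by rewrite -[RHS]reprK /dlim_cl; case: (repr x). Qed.

Lemma dlim_op1E (op : forall k, D k -> D k) k (a : D k) :
  (forall k l (h : (k <= l)%N) x, dmap D h (op k x) = op l (dmap D h x)) ->
  dlim_op1 op (dlim_cl a) = dlim_cl (op k a).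
Proof.
move=> opP; rewrite /dlim_op1.
have /dlim_clP[m [h1 [h2 e]]] := dlim_reprK (dlim_cl a).
by apply/dlim_clP; exists m, h1, h2; rewrite !opP e.
Qed.

Lemma dlim_op2E (op : forall k, D k -> D k -> D k) k (a b : D k) :
  (forall k l (h : (k <= l)%N) x y,
     dmap D h (op k x y) = op l (dmap D h x) (dmap D h y)) ->
  dlim_op2 op (dlim_cl a) (dlim_cl b) = dlim_cl (op k a b).
Proof.
move=> opP; rewrite /dlim_op2; cbv zeta.
have /dlim_clP[m [h1 [h2 e]]] := dlim_reprK (dlim_cl a).
have /dlim_clP[m' [h1' [h2' e']]] := dlim_reprK (dlim_cl b).
set u := repr _ in h1 e *; set v := repr _ in h1' e' *.
have hm : (m <= maxn m m')%N by exact: leq_maxl.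
have hm' : (m' <= maxn m m')%N by exact: leq_maxr.
have hM : (maxn (tag u) (tag v) <= maxn m m')%N.
  by rewrite geq_max (leq_trans h1 hm) (leq_trans h1' hm').
apply/dlim_clP; exists (maxn m m'), hM, (leq_trans h2 hm).
rewrite !opP (dmap_comp _ _ (leq_trans h1 hm)).
rewrite (dmap_comp _ _ (leq_trans h1' hm')).
rewrite -(dmap_comp h1 hm) e -(dmap_comp h1' hm') e'.
rewrite (dmap_comp h2 hm (leq_trans h2 hm)).
by rewrite (dmap_comp h2' hm' (leq_trans h2 hm)).
Qed.

Definition dlim_zero : dlim := dlim_cl (0 : D 0%N).
Definition dlim_one : dlim := dlim_cl (1 : D 0%N).
Definition dlim_opp := dlim_op1 (fun k => @GRing.opp (D k)).
Definition dlim_add := dlim_op2 (fun k => @GRing.add (D k)).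
Definition dlim_mul := dlim_op2 (fun k => @GRing.mul (D k)).

Lemma dlim_zeroE k : dlim_zero = dlim_cl (0 : D k).
Proof. by rewrite -(rmorph0 (dmap D (leq0n k))) dlim_cl_map. Qed.
Lemma dlim_oneE k : dlim_one = dlim_cl (1 : D k).
Proof. by rewrite -(rmorph1 (dmap D (leq0n k))) dlim_cl_map. Qed.
Lemma dlim_oppE k (a : D k) : dlim_opp (dlim_cl a) = dlim_cl (- a).
Proof. by apply: dlim_op1E => *; exact: rmorphN. Qed.
Lemma dlim_addE k (a b : D k) :
  dlim_add (dlim_cl a) (dlim_cl b) = dlim_cl (a + b).
Proof. by apply: dlim_op2E => *; exact: rmorphD. Qed.
Lemma dlim_mulE k (a b : D k) :
  dlim_mul (dlim_cl a) (dlim_cl b) = dlim_cl (a * b).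
Proof. by apply: dlim_op2E => *; exact: rmorphM. Qed.

Lemma dlim_addA : associative dlim_add.
Proof.
move=> x y z; have [k [a [b [c [-> -> ->]]]]] := dlim_ex3 x y z.
by rewrite !dlim_addE addrA.
Qed.
Lemma dlim_addC : commutative dlim_add.
Proof.
move=> x y; have [k [a [b [-> ->]]]] := dlim_ex2 x y.
by rewrite !dlim_addE addrC.
Qed.
Lemma dlim_add0 : left_id dlim_zero dlim_add.
Proof.
by move=> x; have [k [a ->]] := dlim_ex x; rewrite (dlim_zeroE k) dlim_addE add0r.
Qed.
Lemma dlim_addN : left_inverse dlim_zero dlim_opp dlim_add.
Proof.
move=> x; have [k [a ->]] := dlim_ex x.
by rewrite (dlim_zeroE k) dlim_oppE dlim_addE addNr.
Qed.
Lemma dlim_mulA : associative dlim_mul.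
Proof.
move=> x y z; have [k [a [b [c [-> -> ->]]]]] := dlim_ex3 x y z.
by rewrite !dlim_mulE mulrA.
Qed.
Lemma dlim_mul1 : left_id dlim_one dlim_mul.
Proof.
by move=> x; have [k [a ->]] := dlim_ex x; rewrite (dlim_oneE k) dlim_mulE mul1r.
Qed.
Lemma dlim_mulr1 : right_id dlim_one dlim_mul.
Proof.
by move=> x; have [k [a ->]] := dlim_ex x; rewrite (dlim_oneE k) dlim_mulE mulr1.
Qed.
Lemma dlim_mulDl : left_distributive dlim_mul dlim_add.
Proof.
move=> x y z; have [k [a [b [c [-> -> ->]]]]] := dlim_ex3 x y z.
by rewrite !(dlim_addE, dlim_mulE) mulrDl.
Qed.
Lemma dlim_mulDr : right_distributive dlim_mul dlim_add.
Proof.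
move=> x y z; have [k [a [b [c [-> -> ->]]]]] := dlim_ex3 x y z.
by rewrite !(dlim_addE, dlim_mulE) mulrDr.
Qed.

HB.instance Definition _ := GRing.isPzRing.Build dlim
  dlim_addA dlim_addC dlim_add0 dlim_addN
  dlim_mulA dlim_mul1 dlim_mulr1 dlim_mulDl dlim_mulDr.

Definition dlim_fun k : D k -> dlim := @dlim_cl k.

Lemma dlim_fun_zmod k : zmod_morphism (@dlim_fun k).
Proof.
by move=> a b; rewrite /dlim_fun -dlim_addE -dlim_oppE.
Qed.
Lemma dlim_fun_monoid k : monoid_morphism (@dlim_fun k).
Proof.
by split=> [|a b]; rewrite /dlim_fun -?dlim_oneE -?dlim_mulE.
Qed.
HB.instance Definition _ k :=
  GRing.isZmodMorphism.Build (D k) dlim (@dlim_fun k) (@dlim_fun_zmod k).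
HB.instance Definition _ k :=
  GRing.isMonoidMorphism.Build (D k) dlim (@dlim_fun k) (@dlim_fun_monoid k).

Definition dlim_in k : {rmorphism D k -> dlim} := @dlim_fun k.

Definition cocone (T : pzRingType) (c : forall k, {rmorphism D k -> T}) :=
  forall k l (h : (k <= l)%N) (x : D k), c l (dmap D h x) = c k x.

Lemma dlim_in_cocone : cocone dlim_in.
Proof. by move=> k l h x; exact: dlim_cl_map. Qed.

Section Universal.
Variables (T : pzRingType) (c : forall k, {rmorphism D k -> T}).
Hypothesis cP : cocone c.

Definition dlim_desc_fun of cocone c :=
  fun x : dlim => c _ (tagged (repr x)).

Lemma dlim_desc_funE k (a : D k) : dlim_desc_fun cP (dlim_cl a) = c k a.
Proof.
rewrite /dlim_desc_fun.
have /dlim_clP[m [h1 [h2 e]]] := dlim_reprK (dlim_cl a).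
by rewrite -(cP h1) e cP.
Qed.

Lemma dlim_desc_zmod : zmod_morphism (dlim_desc_fun cP).
Proof.
move=> x y; have [k [a [b [-> ->]]]] := dlim_ex2 x y.
by rewrite -!/(dlim_fun _) -rmorphB !dlim_desc_funE rmorphB.
Qed.
Lemma dlim_desc_monoid : monoid_morphism (dlim_desc_fun cP).
Proof.
split; first by rewrite -(rmorph1 (dlim_in 0)) dlim_desc_funE rmorph1.
move=> x y; have [k [a [b [-> ->]]]] := dlim_ex2 x y.
by rewrite -!/(dlim_fun _) -rmorphM !dlim_desc_funE rmorphM.
Qed.
HB.instance Definition _ :=
  GRing.isZmodMorphism.Build dlim T (dlim_desc_fun cP) dlim_desc_zmod.
HB.instance Definition _ :=
  GRing.isMonoidMorphism.Build dlim T (dlim_desc_fun cP) dlim_desc_monoid.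

Definition dlim_desc : {rmorphism dlim -> T} := dlim_desc_fun cP.

Lemma dlim_descE k (a : D k) : dlim_desc (dlim_in k a) = c k a.
Proof. exact: dlim_desc_funE. Qed.

Lemma dlim_desc_uniq (g : {rmorphism dlim -> T}) :
  (forall k (a : D k), g (dlim_in k a) = c k a) -> g = dlim_desc.
Proof.
move=> gP; apply: rmorph_eq => x; have [k [a ->]] := dlim_ex x.
by rewrite [LHS]gP [RHS]dlim_descE.
Qed.

End Universal.
End DirectLimit.

Section MatricialSystem.
Variables (n : nat) (R : pzRingType).

Definition eta (S : pzRingType) : {rmorphism S -> 'M[S]_n} := @scalar_mx S n.

Lemma block_dim k : (\sum_(i < n) n ^ k = n ^ k.+1)%N.
Proof. by rewrite sum_nat_const card_ord expnS. Qed.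

(* The identification of M_n(M_(n^k)(R)) with M_(n^(k+1))(R); the cast is
   needed because [n ^ k.+1] is not convertible to the size of a block matrix. *)
Definition unblock_fun k (B : 'M['M[R]_(n ^ k)]_n) : 'M[R]_(n ^ k.+1) :=
  castmx (block_dim k, block_dim k) (\mxblock_(i < n, j < n) B i j).

Lemma unblock_zmod k : zmod_morphism (@unblock_fun k).
Proof.
move=> A B; rewrite /unblock_fun; case: _ / (block_dim k); rewrite !castmx_id.
by rewrite -mxblockB; apply: eq_mxblock => i j; rewrite !mxE.
Qed.
Lemma unblock_monoid k : monoid_morphism (@unblock_fun k).
Proof.
split=> [|A B]; rewrite /unblock_fun; case: _ / (block_dim k); rewrite !castmx_id.
  rewrite [RHS](_ : _ = 1%:M) // -mxdiagZ /mxdiag; apply: eq_mxblock => i j.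
  by rewrite !mxE conform_mx_id; case: eqP.
rewrite [RHS]mul_mxblock; apply: eq_mxblock => i j.
by rewrite !mxE.
Qed.
HB.instance Definition _ k := GRing.isZmodMorphism.Build
  'M['M[R]_(n ^ k)]_n 'M[R]_(n ^ k.+1) (@unblock_fun k) (@unblock_zmod k).
HB.instance Definition _ k := GRing.isMonoidMorphism.Build
  'M['M[R]_(n ^ k)]_n 'M[R]_(n ^ k.+1) (@unblock_fun k) (@unblock_monoid k).

Definition unblock k : {rmorphism 'M['M[R]_(n ^ k)]_n -> 'M[R]_(n ^ k.+1)} :=
  @unblock_fun k.

(* At [k = 0] this is the ring of 1 x 1 matrices, identified with [R]. *)
Definition mobj (k : nat) : pzRingType := 'M[R]_(n ^ k).

Definition mstep k : {rmorphism mobj k -> mobj k.+1} :=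
  ring_comp (unblock k) (eta (mobj k)).

Lemma mstepE k (A : mobj k) :
  mstep k A = castmx (block_dim k, block_dim k) (\mxdiag_(i < n) A).
Proof.
rewrite /mstep /= /unblock_fun; congr (castmx _ _); apply: eq_mxblock => i j.
by rewrite mxE conform_mx_id; case: eqP.
Qed.

Fixpoint mconn_add k d : {rmorphism mobj k -> mobj (d + k)} :=
  if d is d'.+1 then ring_comp (mstep (d' + k)) (mconn_add k d')
  else ring_id (mobj k).

(* The cast is along the equality [l - k + k = l]. *)
Definition mconn k l (h : (k <= l)%N) : {rmorphism mobj k -> mobj l} :=
  ecast m {rmorphism mobj k -> mobj m} (subnK h) (mconn_add k (l - k)).

Lemma mconn_id k (h : (k <= k)%N) (A : mobj k) : mconn h A = A.
Proof.
rewrite /mconn; move: (subnK h); rewrite subnn => e.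
by rewrite (eq_irrelevance e erefl).
Qed.

Lemma mconnS k l (h : (k <= l)%N) (h' : (k <= l.+1)%N) (A : mobj k) :
  mconn h' A = mstep l (mconn h A).
Proof.
rewrite /mconn; move: (subnK h) (subnK h'); rewrite subSn // => e e'.
move: (l - k)%N e e' => d e; case: _ / e {h h'} => e'.
by rewrite (eq_irrelevance e' erefl).
Qed.

Lemma mconn_comp k l m (h : (k <= l)%N) (h' : (l <= m)%N) (h'' : (k <= m)%N)
    (A : mobj k) :
  mconn h' (mconn h A) = mconn h'' A.
Proof.
elim: m h' h'' => [|m IH] h' h''.
  have e : l = 0%N by apply/eqP; rewrite -leqn0.
  by subst l; rewrite mconn_id (eq_irrelevance h h'').
have [e|ne] := eqVneq l m.+1.
  by subst l; rewrite mconn_id (eq_irrelevance h h'').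
have lm : (l <= m)%N by rewrite -ltnS ltn_neqAle ne.
by rewrite (mconnS lm) (mconnS (leq_trans h lm)) (IH lm (leq_trans h lm)).
Qed.

Definition msystem : dsystem := @DSystem mobj mconn mconn_id mconn_comp.

Definition MC : pzRingType := dlim msystem.

Definition MC_in k : {rmorphism 'M[R]_(n ^ k) -> MC} := dlim_in msystem k.

End MatricialSystem.

Definition map_mor (m : nat) (R S : pzRingType) (f : {rmorphism R -> S}) :
  {rmorphism 'M[R]_m -> 'M[S]_m} := map_mx f.

Section MatricialMap.
Variables (n : nat) (R S : pzRingType) (f : {rmorphism R -> S}).

Lemma map_mor_step k (A : mobj n R k) :
  map_mor (n ^ k.+1) f (mstep n R k A) = mstep n S k (map_mor (n ^ k) f A).
Proof.
rewrite !mstepE /= map_castmx; congr (castmx _ _).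
apply/matrixP => a b; rewrite !mxE.
by case: eqP => _; rewrite ?conform_mx_id ?mxE ?rmorph0.
Qed.

Lemma map_mor_conn k l (h : (k <= l)%N) (A : mobj n R k) :
  map_mor (n ^ l) f (mconn n R h A) = mconn n S h (map_mor (n ^ k) f A).
Proof.
rewrite /mconn; move: (subnK h); move: (l - k)%N => d e.
case: _ / e {h} => /=.
elim: d => //= d IH.
by rewrite [LHS]map_mor_step; congr (mstep n S _ _).
Qed.

Definition MC_leg k : {rmorphism msystem n R k -> MC n S} :=
  ring_comp (MC_in n S k) (map_mor (n ^ k) f).

Lemma MC_leg_cocone : cocone MC_leg.
Proof.
move=> k l h A; rewrite /MC_leg /=.
by rewrite [map_mx f _]map_mor_conn; exact: (@dlim_in_cocone (msystem n S)).
Qed.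

Definition MC_map : {rmorphism MC n R -> MC n S} := dlim_desc MC_leg_cocone.

Lemma MC_map_in k :
  ring_comp MC_map (MC_in n R k) = ring_comp (MC_in n S k) (map_mor (n ^ k) f).
Proof. by apply: rmorph_eq => A; exact: dlim_descE. Qed.

Lemma MC_map_uniq (g : {rmorphism MC n R -> MC n S}) :
  (forall k, ring_comp g (MC_in n R k) =
             ring_comp (MC_in n S k) (map_mor (n ^ k) f)) ->
  g = MC_map.
Proof.
move=> gP; apply: dlim_desc_uniq => k A.
by rewrite -[RHS](congr1 (fun h : {rmorphism _ -> _} => h A) (gP k)).
Qed.

End MatricialMap.

(* Main.v *)
(* Both functor laws follow from the uniqueness of the morphism out of the
   direct limit that is compatible with the entrywise maps at every level,
   since applying a morphism entrywise is itself functorial. *)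
Require Import Defs.
From mathcomp Require Import all_boot all_algebra.

Lemma map_mor_id (m : nat) (R : pzRingType) :
  map_mor m (ring_id R) = ring_id 'M[R]_m.
Proof. by apply: rmorph_eq => A; apply: map_mx_id. Qed.

Lemma map_mor_comp (m : nat) (R S T : pzRingType)
    (g : {rmorphism S -> T}) (f : {rmorphism R -> S}) :
  map_mor m (ring_comp g f) =
  ring_comp (map_mor m g) (map_mor m f).
Proof. by apply: rmorph_eq => A; apply: map_mx_comp. Qed.

Theorem proposition3 (n : nat) (n_gt0 : (0 < n)%N) :
  @is_functor Rings Rings (@MC n) (@MC_map n).
Proof.
(* [MC_map_uniq] needs [MC_map] alone on the right, hence the symmetry. The candidate morphism is
   the identity in one case, the composite in the other, to be checked on each [MC_in]. *)
split=> [R | R S T g f]; apply/esym; apply: MC_map_uniq => k.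
  by rewrite map_mor_id ring_id_comp ring_comp_id.
(* Two commuting squares are pasted: the one for [f] turns [MC_in] of [R] into [MC_in] of [S], which
   reassociation then brings next to [MC_map] of [g]. *)
by rewrite map_mor_comp -ring_compA MC_map_in !ring_compA MC_map_in.
Qed.
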